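(* Let $\ell\ge 3$ be an integer, and let $G$ be a bipartite graph whose two bipartition classes have unequal cardinalities. Let $V(G)=V_+\sqcup V_-$ be its bipartition, labelled so that $|V_+|>|V_-|$, let $\sigma$ be the corresponding sign vector, and write $Q=Q(G)$. The following are equivalent. (a) $G$ has exactly $\ell$ distinct $Q$-main eigenvalues, one of which is zero. (b) There exist $t\in\mathbb{Z}_{>0}$ and a monic polynomial $p\in\mathbb{Z}[x]$ of degree $\ell-1$, whose roots are all distinct and positive (real), such that (i) $\mathbf{1},Q\mathbf{1},\ldots,Q^{\ell-2}\mathbf{1},\sigma$ are linearly independent; and (ii) $p(Q)\mathbf{1}=(-1)^{\ell-1}t\,\sigma$. In this case (for any such $p$), $\Phi_Q(G,x)=x\,p(x)$.
   Context: All graphs are finite, simple, connected, undirected, and have at least one edge. For a graph $G$, $A(G)$ is the adjacency matrix, $D(G)$ the diagonal matrix of vertex degrees, and $Q(G)=A(G)+D(G)$ is the signless Laplacian; $\mathbf{1}$ is the all-ones vector. An eigenvalue $\lambda$ of $Q(G)$ is $Q$-main if its eigenspace is not orthogonal to $\mathbf{1}$. If the distinct $Q$-main eigenvalues of $G$ are $\lambda_1,\ldots,\lambda_\ell$, the $Q$-main polynomial of $G$ is $\Phi_Q(G,x)=\prod_{i=1}^{\ell}(x-\lambda_i)$. Since $G$ is connected, its bipartition is unique up to swapping the classes. The sign vector of an ordered bipartition $V(G)=V_+\sqcup V_-$ is $\sigma\in\{1,-1\}^{V(G)}$ with $\sigma(v)=1$ for $v\in V_+$ and $\sigma(v)=-1$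 for $v\in V_-$. *)

(* Defs.v *)
From HB Require Import structures.
From mathcomp Require Import all_boot all_order all_algebra.
From mathcomp Require Import polyrcf.

Set Implicit Arguments.
Unset Strict Implicit.
Unset Printing Implicit Defensive.

Import Order.TTheory GRing.Theory Num.Theory.
Local Open Scope ring_scope.

(* A simple graph on a finite vertex type T is given by its adjacency relation
   e : rel T; matrices and vectors are indexed by 'I_#|T| through enum_val. *)

Section Graph.

Variables (T : finType) (e : rel T).

Definition connected_graph := forall x y : T, connect e x y.

Definition degree (x : T) : nat := #|[set y | e x y]|.

Definition independent (A : {set T}) := {in A &, forall x y, ~~ e x y}.

Definition bipartition (Vp Vm : {set T}) :=
  [/\ Vp :|: Vm = [set: T], [disjoint Vp & Vm],
      independent Vp & independent Vm].

End Graph.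

Section Spectrum.

Variable R : rcfType.

Definition ones n : 'cV[R]_n := const_mx 1.

Definition adjacency_mx (T : finType) (e : rel T) : 'M[R]_#|T| :=
  \matrix_(i, j) (e (enum_val i) (enum_val j))%:R.

Definition degree_mx (T : finType) (e : rel T) : 'M[R]_#|T| :=
  diag_mx (\row_i (degree e (enum_val i))%:R).

Definition signless_laplacian (T : finType) (e : rel T) : 'M[R]_#|T| :=
  adjacency_mx e + degree_mx e.

Definition sign_vector (T : finType) (Vp : {set T}) : 'cV[R]_#|T| :=
  \col_i (if enum_val i \in Vp then 1 else -1).

(* The library's eigenspaces consist of row vectors; this is immaterial below
   since the matrices considered are symmetric.  The eigenspace is orthogonal
   to the all-ones vector exactly when the product below vanishes. *)
Definition main_eigenvalue n (A : 'M[R]_n) (a : R) : bool :=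
  eigenvalue A a && (eigenspace A a *m ones n != 0).

Definition main_eigenvalues n (A : 'M[R]_n) : seq R :=
  [seq a <- rootsR (char_poly A) | main_eigenvalue A a].

Lemma mem_main_eigenvalues n (A : 'M[R]_n) (a : R) :
  (a \in main_eigenvalues A) = main_eigenvalue A a.
Proof.
rewrite mem_filter; apply: andb_idr => /andP[].
have cA0 : char_poly A != 0 by rewrite monic_neq0 ?char_poly_monic.
by rewrite eigenvalue_root_char -(roots_on_rootsR cA0) in_itv.
Qed.

Lemma uniq_main_eigenvalues n (A : 'M[R]_n) : uniq (main_eigenvalues A).
Proof. by rewrite filter_uniq // uniq_roots. Qed.

Definition main_poly n (A : 'M[R]_n) : {poly R} :=
  \prod_(a <- main_eigenvalues A) ('X - a%:P).

(* p(A) for a square matrix of arbitrary size; horner_mx only covers sizes of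
   the syntactic form n.+1. *)
Definition poly_mx n (p : {poly R}) (A : 'M[R]_n) : 'M[R]_n :=
  \sum_(i < size p) p`_i *: A ^+ i.

Lemma poly_mxE n (p : {poly R}) (A : 'M[R]_n.+1) : poly_mx p A = horner_mx A p.
Proof.
rewrite -[p in RHS]coefK poly_def rmorph_sum; apply: eq_bigr => i _.
by rewrite /= horner_mxZ rmorphXn /= horner_mx_X.
Qed.

(* All the roots of p (in any extension of R) are simple, lie in R and are
   positive; stated for monic p. *)
Definition distinct_positive_roots (p : {poly R}) :=
  exists s : seq R,
    [/\ p = \prod_(a <- s) ('X - a%:P), uniq s & all (fun a => 0 < a) s].

(* Condition (b) on the pair (t, p); size p = l means that p has degree
   l - 1. *)
Definition main_relation n (A : 'M[R]_n) (sigma : 'cV[R]_n) (l : nat)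
    (t : nat) (p : {poly int}) :=
  let pR := map_poly intr p : {poly R} in
  [/\ (0 < t)%N, p \is monic, size p = l, distinct_positive_roots pR
    & free (rcons [seq A ^+ i *m ones n | i <- iota 0 l.-1] sigma)
      /\ poly_mx pR A *m ones n = ((-1) ^+ l.-1 * t%:R) *: sigma].

End Spectrum.

(* Main.v *)
Require Import Defs.
From HB Require Import structures.
From mathcomp Require Import all_boot all_order all_algebra.
From mathcomp Require Import polyrcf complex.

Set Implicit Arguments.
Unset Strict Implicit.
Unset Printing Implicit Defensive.

Import Order.TTheory GRing.Theory Num.Theory.
Local Open Scope ring_scope.

(** Let [A] be a real symmetric matrix, [j] the all-ones vector and [M] its
    main polynomial.  Everything rests on the fact that [M] generates the ideal
    of the polynomials [q] with [q(A) j = 0] ([dvdp_main_poly]): eigenspaces of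
    [A] are orthogonal and fill the space, so [j] is the sum of its components
    in them, and [q(A)] kills [j] exactly when [q] vanishes at each eigenvalue
    whose component is nonzero, that is, at each main eigenvalue.

    When [A] has integer entries, so does [M] ([main_poly_int]): linear
    relations between the vectors [A^i j] already exist over the rationals, so
    [M] is rational, and as a monic factor of the characteristic polynomial it
    is integral by Gauss's lemma.

    For the signless Laplacian [Q] of a connected bipartite graph, the identity
    [x^T Q x = \sum_(uv) (x_u + x_v)^2], with the sum over the edges [uv],
    shows that [Q] is positive semidefinite and that its kernel is the line of the sign vector [sigma]
    ([signless_laplacian_ker]).

    From (a) to (b): [M = X p] with [p] integral and with positive simple
    roots, and [Q (p(Q) j) = 0], so [p(Q) j = c sigma] for an integer [c]
    ([Q] and [j] are integral).  Pairing with [sigma], which satisfies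
    [sigma^T Q = 0], gives [c |sigma|^2 = p(0) (sigma^T j)]; here
    [sigma^T j = |V+| - |V-| > 0] and [p(0)] is [(-1)^(l-1)] times a product of
    positive numbers, whence the sign of [c].  As [p(Q) j] is a nonzero
    multiple of [sigma], condition (i) says that no nonzero polynomial of
    degree less than [l] kills [j] ([free_krylov_rcons]), which holds because
    [M] has degree [l].

    From (b) to (a): [X p] kills [j], so [M] divides [X p]; by (i) the degree
    of [M] is at least [l], so [M = X p] ([main_relation_main_poly]). *)

(** * The main polynomial as the annihilator of the all-ones vector *)

(** Over the complex extension [R[i]] the spectral theorem diagonalizes [A] with
    real diagonal [d]; the product of the [X - d_i] kills [A] there, and its
    coefficients already lie in [R]. *)
Lemma symmetric_split_annihilator (R : rcfType) n (A : 'M[R]_n.+1) :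
  A^T = A -> exists s : seq R, horner_mx A (\prod_(a <- s) ('X - a%:P)) = 0.
Proof.
move=> A_sym; pose f := real_complex R; pose C := map_mx f A.
have C_herm : C \is hermsymmx.
  apply/is_hermitianmxP; rewrite expr0 scale1r; apply/matrixP=> i j.
  rewrite !mxE -{1}A_sym mxE.
  by apply/esym/CrealP/complex_realP; exists (A j i).
have /mxOverP d_real := hermitian_spectral_diag_real C_herm.
have /hermitian_normalmx/orthomx_spectralP := C_herm.
set P := spectralmx C; set d := spectral_diag C => C_eq.
pose s := [seq complex.Re (d 0 i) | i <- enum 'I_n.+1]; exists s.
apply: (map_mx_inj (f := f)).
rewrite map_horner_mx map_mx0 -/C.
rewrite C_eq horner_mx_uconjC ?spectral_unit// horner_mx_diag.
suff -> : map_mx (horner (map_poly f (\prod_(a <- s) ('X - a%:P)))) d = 0.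
  by rewrite linear0 mulmx0 mul0mx.
apply/rowP=> i; rewrite !mxE; apply/rootP.
rewrite -[d 0 i]RRe_real ?d_real// fmorph_root root_prod_XsubC.
by apply/mapP; exists i; rewrite ?mem_enum.
Qed.

Lemma trmx_mulmx_ge0 (R : realDomainType) n (x : 'cV[R]_n) :
  0 <= (x^T *m x) 0 0.
Proof.
by rewrite mxE; apply: sumr_ge0 => i _; rewrite !mxE -expr2 sqr_ge0.
Qed.

Lemma trmx_mulmx_eq0 (R : realDomainType) n (x : 'cV[R]_n) :
  x^T *m x = 0 -> x = 0.
Proof.
move=> /matrixP/(_ 0 0); rewrite !mxE => /eqP.
rewrite psumr_eq0 => [/allP x0|i _]; last by rewrite !mxE -expr2 sqr_ge0.
apply/colP=> i; rewrite [RHS]mxE; apply/eqP.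
by have := x0 i (mem_index_enum i); rewrite mxE mulf_eq0 orbb.
Qed.

Section Annihilator.

Variables (R : rcfType) (n : nat) (A : 'M[R]_n.+1).
Local Notation one := (ones R n.+1).

Lemma row_eigen_horner (v : 'rV[R]_n.+1) a p :
  v *m A = a *: v -> v *m horner_mx A p = p.[a] *: v.
Proof.
move=> vA; elim/poly_ind: p => [|p c IHp].
  by rewrite rmorph0 mulmx0 horner0 scale0r.
rewrite hornerMXaddC rmorphD rmorphM /= horner_mx_X horner_mx_C.
by rewrite mulmxDr mulmxA IHp -scalemxAl vA scalerA mul_mx_scalar scalerDl.
Qed.

Lemma main_eigenvalueP a :
  reflect (exists2 v : 'rV[R]_n.+1, v *m A = a *: v & v *m one != 0)
          (main_eigenvalue A a).
Proof.
apply: (iffP andP) => [[_ E1]|[v vA v1]].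
  have /cV0Pn[i Ei] := E1; exists (row i (eigenspace A a)).
    by apply/eigenspaceP; rewrite row_sub.
  by apply/cV0Pn; exists 0; rewrite -row_mul mxE.
have v0 : v != 0 by apply: contraNneq v1 => ->; rewrite mul0mx.
split; first by apply/eigenvalueP; exists v.
have /eigenspaceP/submxP[D vE] := vA.
by apply: contraNneq v1 => E1; rewrite vE -mulmxA E1 mulmx0.
Qed.

Hypothesis A_sym : A^T = A.

(** Start from a split polynomial that kills [A] and remove its linear factors
    one at a time, keeping the factor [main_poly A].  If [X - a] is removed from
    [(X - a) q], then [u = q(A) 1] satisfies [A u = a u], hence
    [u^T u = q(a) (u^T 1)], and this vanishes: either [a] is main and is a root
    of [q], or every eigenvector for [a] is orthogonal to [1].  Positivity of
    [u^T u] then gives [u = 0]. *)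
Lemma horner_mx_main_poly : horner_mx A (main_poly A) *m one = 0.
Proof.
have [s sA0] := symmetric_split_annihilator A_sym.
have {sA0} : horner_mx A (\prod_(a <- s) ('X - a%:P) * main_poly A) *m one = 0.
  by rewrite rmorphM /= sA0 mul0r mul0mx.
elim: s => [|a s IHs]; first by rewrite big_nil mul1r.
rewrite big_cons -mulrA; set q := _ * main_poly A => Aq0.
apply: IHs; rewrite -/q; set u := _ *m _.
have uA : u^T *m A = a *: u^T.
  rewrite -{1}A_sym -trmx_mul -linearZ; congr _^T; apply/eqP.
  rewrite -subr_eq0 -mul_scalar_mx -mulmxBl mulmxA.
  have <- : horner_mx A ('X - a%:P) = A - a%:M.
    by rewrite rmorphB /= horner_mx_X horner_mx_C.
  by rewrite -[_ *m horner_mx A q]rmorphM Aq0.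
apply: trmx_mulmx_eq0; rewrite {2}/u mulmxA (row_eigen_horner _ uA) -scalemxAl.
have [a_main|a_main] := boolP (main_eigenvalue A a).
  suff -> : q.[a] = 0 by rewrite scale0r.
  apply/rootP; rewrite rootM orbC /main_poly root_prod_XsubC.
  by rewrite mem_main_eigenvalues a_main.
suff -> : u^T *m one = 0 by rewrite scaler0.
apply/eqP; apply: contraNT a_main => u1.
by apply/main_eigenvalueP; exists u^T.
Qed.

(** Conversely to the previous lemma, if [q(A) 1 = 0] and [v] is an eigenvector
    for a main eigenvalue [a] with [v 1 <> 0], then [q(a) (v 1) = 0], so [q] has
    every main eigenvalue as a root. *)
Lemma dvdp_main_poly q :
  (main_poly A %| q) = (horner_mx A q *m one == 0).
Proof.
apply/idP/eqP => [/dvdpP[r ->]|Aq0].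
  by rewrite rmorphM /= -mulmxA horner_mx_main_poly mulmx0.
have [||r ->] := @uniq_roots_prod_XsubC _ q (main_eigenvalues A).
- apply/allP=> a; rewrite mem_main_eigenvalues => /main_eigenvalueP[v vA v1].
  have /eqP : q.[a] *: (v *m one) = 0.
    by rewrite scalemxAl -row_eigen_horner// -mulmxA Aq0 mulmx0.
  by rewrite scalemx_eq0 (negPf v1) orbF.
- by rewrite uniq_rootsE uniq_main_eigenvalues.
exact: dvdp_mull.
Qed.

End Annihilator.

(** * Krylov vectors and integrality of the main polynomial *)

Lemma horner_mx_wide (R : comNzRingType) n (A : 'M[R]_n.+1) d (q : {poly R}) :
  (size q <= d)%N -> horner_mx A q = \sum_(i < d) q`_i *: A ^+ i.
Proof.
move=> q_le; rewrite -{1}(coefK q) poly_def rmorph_sum /=.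
under eq_bigr => i _ do rewrite horner_mxZ rmorphXn /= horner_mx_X.
rewrite (big_ord_widen _ (fun i => q`_i *: A ^+ i) q_le) big_mkcond /=.
by apply: eq_bigr => i _; case: ltnP => // qi; rewrite nth_default ?scale0r.
Qed.

Section Krylov.

Variables (F : fieldType) (n : nat).

Definition krylov (A : 'M[F]_n.+1) (u : 'cV[F]_n.+1) d : 'M[F]_(d, n.+1) :=
  \matrix_(i < d) (A ^+ i *m u)^T.

Lemma mul_rV_krylov A u d (v : 'rV_d) :
  v *m krylov A u d = (horner_mx A (rVpoly v) *m u)^T.
Proof.
rewrite (horner_mx_wide _ (size_poly _ _)) mulmx_suml linear_sum /=.
rewrite mulmx_sum_row.
apply: eq_bigr => i _; rewrite rowK coef_rVpoly_ord -scalemxAl.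
by rewrite linearZ.
Qed.

Lemma row_free_krylovP A u d :
  reflect (forall q : {poly F}, (size q <= d)%N ->
             horner_mx A q *m u = 0 -> q = 0)
          (row_free (krylov A u d)).
Proof.
apply: (iffP idP) => [K_free q q_le qu|K_inj].
  rewrite -(poly_rV_K q_le); set v := poly_rV q.
  suff -> : v = 0 by rewrite linear0.
  apply: (row_free_inj K_free).
  by rewrite mul_rV_krylov poly_rV_K // qu mul0mx trmx0.
apply: inj_row_free => v; rewrite mul_rV_krylov => /(congr1 trmx).
rewrite trmxK trmx0 => vu; rewrite -[v]rVpolyK.
by rewrite (K_inj (rVpoly v)) ?linear0 // size_poly.
Qed.

End Krylov.

(** The rank of a matrix does not change under field extension, so linear
    dependence of the Krylov vectors over the big field yields a dependence of
    the same length over the small one. *)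
Lemma annihilator_descent (F E : fieldType) (f : {rmorphism F -> E}) n
    (A : 'M[F]_n.+1) (u : 'cV[F]_n.+1) (q : {poly E}) :
    q != 0 -> horner_mx (map_mx f A) q *m map_mx f u = 0 ->
  exists q0 : {poly F},
    [/\ q0 != 0, (size q0 <= size q)%N & horner_mx A q0 *m u = 0].
Proof.
move=> q0 qu; have : ~~ row_free (krylov A u (size q)).
  rewrite -(row_free_map f).
  suff -> : map_mx f (krylov A u (size q)) =
            krylov (map_mx f A) (map_mx f u) (size q).
    apply/row_free_krylovP => /(_ q (leqnn _) qu) /eqP; exact/negP.
  apply/row_matrixP=> i; rewrite -map_row !rowK -map_trmx map_mxM.
  by rewrite rmorphXn.
rewrite -kermx_eq0 => /rowV0Pn[v /sub_kermxP vK v0].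
exists (rVpoly v); split; last 2 first.
- exact: size_poly.
- by apply: trmx_inj; rewrite -mul_rV_krylov vK trmx0.
by apply: contraNneq v0 => v0; rewrite -[v]rVpolyK v0 linear0.
Qed.

(** Gauss's lemma: the leading coefficient of an integral factor of a monic
    polynomial is a unit, so it can be normalized to [1]. *)
Lemma monic_int_of_dvdp (q : {poly rat}) (P : {poly int}) :
    P \is monic -> q %| map_poly intr P ->
  exists a p, [/\ a != 0, p \is monic & q = a *: map_poly intr p].
Proof.
move=> P_monic /dvdpP_rat_int[p [a a0 ->] [r PE]].
have lead_unit : lead_coef p * lead_coef p = 1.
  have : lead_coef p \is a GRing.unit.
    apply/unitrPr; exists (lead_coef r).
    by rewrite -lead_coefM -PE (monicP P_monic).
  by rewrite unfold_in /= => /orP[]/eqP->.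
exists (a * (lead_coef p)%:~R), (lead_coef p *: p); split.
- rewrite mulf_neq0// intr_eq0; apply/eqP => l0.
  by move: lead_unit; rewrite l0.
- by rewrite monicE lead_coefZ lead_unit.
by rewrite map_polyZ /= scalerA -mulrA -intrM lead_unit mulr1.
Qed.

(** The bound on the size of the rational annihilator is what makes it
    associated to [main_poly A], rather than merely a multiple of it. *)
Lemma main_poly_int (R : rcfType) n (B : 'M[int]_n.+1) :
    let A : 'M[R]_n.+1 := map_mx intr B in A^T = A ->
  exists2 P : {poly int}, P \is monic & main_poly A = map_poly intr P.
Proof.
move=> A A_sym; pose AQ : 'M[rat]_n.+1 := map_mx intr B.
have AE : map_mx ratr AQ = A.
  by rewrite -map_mx_comp; apply: eq_map_mx => z /=; rewrite ratr_int.
pose oneQ : 'cV[rat]_n.+1 := const_mx 1.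
have oneE : map_mx ratr oneQ = ones R n.+1 by rewrite map_const_mx rmorph1.
have M_monic : main_poly A \is monic by exact: monic_prod_XsubC.
have [||q [q0 q_le qA]] :=
  @annihilator_descent _ _ (ratr : rat -> R) _ AQ oneQ (main_poly A).
- exact: monic_neq0.
- by rewrite AE oneE horner_mx_main_poly.
have M_dvd : main_poly A %| map_poly ratr q.
  rewrite dvdp_main_poly // -AE -map_horner_mx -oneE -map_mxM.
  by rewrite qA map_mx0.
have M_eqp : main_poly A %= map_poly ratr q.
  rewrite -dvdp_size_eqp // size_map_poly eqn_leq q_le andbT.
  by have := dvdp_leq _ M_dvd; rewrite size_map_poly map_poly_eq0; apply.
have : q %| char_poly AQ.
  rewrite -(dvdp_map (ratr : rat -> R)) -(eqp_dvdl _ M_eqp) dvdp_main_poly//.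
  by rewrite map_char_poly AE Cayley_Hamilton mul0mx.
rewrite -map_char_poly => /(monic_int_of_dvdp (char_poly_monic _)).
move=> [a [p [a0 p_monic qE]]].
exists p => //; apply/eqP.
rewrite -eqp_monic ?monic_map//; apply: (eqp_trans M_eqp).
rewrite qE map_polyZ -map_poly_comp.
rewrite (eq_map_poly (g := intr)); last by move=> z /=; rewrite ratr_int.
by apply: eqp_scale; rewrite fmorph_eq0.
Qed.

(** Since [p(A) u] is a nonzero multiple of [w] with [p] monic of degree [d],
    the vector [w] can play the role of [A^d u]: the family is free exactly
    when [u, A u, ..., A^d u] is. *)
Lemma free_krylov_rcons (F : fieldType) n (A : 'M[F]_n.+1) (u w : 'cV[F]_n.+1)
    d (p : {poly F}) (c : F) :
    p \is monic -> size p = d.+1 -> c != 0 -> horner_mx A p *m u = c *: w ->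
  free (rcons [seq A ^+ i *m u | i <- iota 0 d] w)
  <-> (forall q : {poly F}, (size q <= d.+1)%N ->
         horner_mx A q *m u = 0 -> q = 0).
Proof.
move=> p_monic p_size c0 pu.
have pd : p`_d = 1 by rewrite -(monicP p_monic) lead_coefE p_size.
pose X : d.+1.-tuple 'cV[F]_n.+1 :=
  [tuple of rcons [seq A ^+ i *m u | i <- iota 0 d] w].
have XE (k : 'I_d.+1 -> F) (r : {poly F}) : (size r <= d)%N ->
    (forall i : 'I_d, r`_i = k (widen_ord (leqnSn d) i)) ->
    \sum_i k i *: X`_i = horner_mx A (r + (k ord_max / c) *: p) *m u.
  move=> r_le rk; rewrite rmorphD /= horner_mxZ mulmxDl -scalemxAl pu.
  rewrite scalerA divfK//.
  rewrite big_ord_recr /= nth_rcons size_map size_iota ltnn eqxx; congr (_ + _).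
  rewrite (horner_mx_wide _ r_le) mulmx_suml; apply: eq_bigr => i _ /=.
  rewrite nth_rcons size_map size_iota ltn_ord (nth_map 0%N) ?size_iota//.
  by rewrite nth_iota// add0n -rk scalemxAl.
rewrite -[rcons _ _]/(tval X); split => [/freeP X_free q q_le qu|q_inj].
  pose r := q - q`_d *: p.
  have r_le : (size r <= d)%N.
    apply/leq_sizeP => j; rewrite leq_eqVlt coefB coefZ => /orP[/eqP<-|dj].
      by rewrite pd mulr1 subrr.
    have qj : q`_j = 0 by apply/(leq_sizeP _ _ q_le).
    by rewrite qj sub0r [p`_j]nth_default ?p_size// mulr0 oppr0.
  (* Coordinates of [q(A) u = r(A) u + q_d p(A) u] in the given family. *)
  pose k (i : 'I_d.+1) := if (i < d)%N then r`_i else c * q`_d.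
  have k0 : forall i, k i = 0.
    apply: X_free; rewrite (XE k r) // => [|i]; last by rewrite /k /= ltn_ord.
    by rewrite /k /= ltnn (mulrC c) mulfK// subrK.
  have qd0 : q`_d = 0.
    by have /eqP := k0 ord_max; rewrite /k /= ltnn mulf_eq0 (negPf c0) => /eqP.
  suff r0 : r = 0 by rewrite -[q](subrK (q`_d *: p)) -/r r0 qd0 scale0r addr0.
  apply/polyP=> i; rewrite coef0; case: (ltnP i d) => [id|di].
    by have := k0 (widen_ord (leqnSn d) (Ordinal id)); rewrite /k /= id.
  by rewrite nth_default// (leq_trans r_le).
apply/freeP=> k kX; pose r := \poly_(i < d) k (inord i).
have r_le : (size r <= d)%N by apply: size_poly.
have rk (i : 'I_d) : r`_i = k (widen_ord (leqnSn d) i).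
  rewrite coef_poly ltn_ord; congr k; apply: val_inj => /=.
  by rewrite inordK// ltnS ltnW.
have q0 : r + (k ord_max / c) *: p = 0.
  apply: q_inj; last by rewrite -XE.
  rewrite (leq_trans (size_polyD _ _))// geq_max (leq_trans r_le)//=.
  by rewrite (leq_trans (size_scale_leq _ _)) ?p_size.
have kd0 : k ord_max = 0.
  have /eqP := congr1 (fun q : {poly F} => q`_d) q0.
  rewrite coefD coefZ pd coef0 nth_default// add0r mulr1 mulf_eq0 invr_eq0.
  by rewrite (negPf c0) orbF => /eqP.
move: q0; rewrite kd0 mul0r scale0r addr0 => r0 i.
have [id|] := ltnP i d; last first.
  move=> di; rewrite -[RHS]kd0; congr k; apply/val_inj/eqP.
  by rewrite eqn_leq di -ltnS /= ltn_ord.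
by have := rk (Ordinal id); rewrite r0 coef0 => ->; congr k; apply: val_inj.
Qed.

(** * Main eigenvalue zero of an integral positive semidefinite matrix *)

Lemma size_main_poly (R : rcfType) n (A : 'M[R]_n) :
  size (main_poly A) = (size (main_eigenvalues A)).+1.
Proof. exact: size_prod_XsubC. Qed.

(** [X p] kills [1], so [main_poly A] divides it, and freeness forbids a degree
    smaller than that of [X p]. *)
Lemma main_relation_main_poly (R : rcfType) n (A : 'M[R]_n.+1)
    (sigma : 'cV[R]_n.+1) l t (p : {poly int}) :
    A^T = A -> A *m sigma = 0 -> main_relation A sigma l t p ->
  main_poly A = 'X * map_poly intr p.
Proof.
move=> A_sym A_sigma [t_gt0 p_monic p_size _ [X_free]].
have l_gt0 : (0 < l)%N by rewrite -p_size size_poly_gt0 monic_neq0.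
rewrite poly_mxE; set pR := map_poly _ p => pA.
have pR_monic : pR \is monic by apply: monic_map.
have pR_size : size pR = l.-1.+1.
  by rewrite size_map_inj_poly ?prednK//; apply: intr_inj.
set c := _ * _ in pA; have c0 : c != 0.
  by rewrite mulf_neq0 ?signr_eq0// pnatr_eq0 -lt0n.
have small_inj := (free_krylov_rcons pR_monic pR_size c0 pA).1 X_free.
have M_monic : main_poly A \is monic by exact: monic_prod_XsubC.
apply/eqP; rewrite -eqp_monic ?monicMr ?monicX//.
have M_dvd : main_poly A %| 'X * pR.
  rewrite dvdp_main_poly// rmorphM /= horner_mx_X -mulmxA pA -scalemxAr.
  by rewrite A_sigma scaler0.
rewrite -dvdp_size_eqp// eqn_leq dvdp_leq//=; last first.
  by rewrite monic_neq0 ?monicMr ?monicX.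
rewrite size_monicM ?monicX ?monic_neq0// size_polyX pR_size prednK// leqNgt.
apply/negP; rewrite /= ltnS => M_le.
have /eqP : main_poly A = 0.
  by apply: small_inj; rewrite ?prednK// horner_mx_main_poly.
by rewrite (negPf (monic_neq0 M_monic)).
Qed.

Lemma main_eigenvalue_ge0 (R : rcfType) n (A : 'M[R]_n.+1) a :
    (forall x : 'cV[R]_n.+1, 0 <= (x^T *m A *m x) 0 0) ->
  a \in main_eigenvalues A -> 0 <= a.
Proof.
move=> A_psd; rewrite mem_main_eigenvalues => /main_eigenvalueP[v vA v1].
have := A_psd v^T; rewrite trmxK vA -scalemxAl mxE.
have := trmx_mulmx_ge0 v^T; rewrite le_eqVlt => /orP[/eqP vv0|]; last first.
  by rewrite trmxK => /pmulr_lge0 ->.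
case/eqP: v1; suff -> : v = 0 by rewrite mul0mx.
apply: trmx_inj; rewrite trmx0; apply: trmx_mulmx_eq0.
by apply/matrixP=> i k; rewrite !ord1 -vv0 mxE.
Qed.

(** The polynomial [p] is [main_poly A] divided by [X].  The entry of [sigma]
    equal to [1] serves to read off the scalar in [p(A) 1 = c sigma] as an entry
    of an integral vector. *)
Lemma main_relation_exists (R : rcfType) n (B : 'M[int]_n.+1)
    (sigma : 'cV[R]_n.+1) i0 l (A := map_mx intr B : 'M[R]_n.+1) :
    A^T = A -> (forall x : 'cV[R]_n.+1, 0 <= (x^T *m A *m x) 0 0) ->
    A *m sigma = 0 ->
    (forall x : 'cV[R]_n.+1, A *m x = 0 -> exists c, x = c *: sigma) ->
    sigma i0 0 = 1 -> 0 < (sigma^T *m ones R n.+1) 0 0 ->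
    size (main_eigenvalues A) = l -> 0 \in main_eigenvalues A ->
  exists t p, main_relation A sigma l t p.
Proof.
move=> A_sym A_psd A_sigma A_ker sigma_i0 sigma_one l_size main0.
have [P P_monic ME] := main_poly_int A_sym.
have P_root : root P 0.
  have : root (main_poly A) 0 by rewrite /main_poly root_prod_XsubC.
  by rewrite ME !rootE !horner_coef0 coef_map intr_eq0.
have {P_root} [p PE] : exists p, P = 'X * p.
  by have /factor_theorem[p ->] := P_root; exists p; rewrite subr0 mulrC.
have p_monic : p \is monic by rewrite PE monicMl ?monicX in P_monic.
have p_size : size p = l.
  have := size_main_poly A; rewrite ME l_size size_map_inj_poly//;
    last exact: intr_inj.
  by rewrite PE size_monicM ?monicX ?monic_neq0// size_polyX => -[].
have l_gt0 : (0 < l)%N by rewrite -p_size size_poly_gt0 monic_neq0.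
set pR : {poly R} := map_poly intr p.
have {}ME : main_poly A = 'X * pR by rewrite ME PE rmorphM /= map_polyX.
pose s := rem 0 (main_eigenvalues A).
have pR_prod : pR = \prod_(a <- s) ('X - a%:P).
  apply: (mulfI (negbT (polyX_eq0 R))); rewrite -ME /main_poly.
  by rewrite (perm_big _ (perm_to_rem main0)) big_cons subr0.
have s_size : size s = l.-1 by rewrite size_rem// l_size.
have s_pos : all (fun a => 0 < a) s.
  apply/allP=> a; rewrite (mem_rem_uniq _ (uniq_main_eigenvalues A)) inE.
  by move=> /andP[a0 /(main_eigenvalue_ge0 A_psd)]; rewrite lt_neqAle eq_sym a0.
have [c pA] : exists c, horner_mx A pR *m ones R n.+1 = c *: sigma.
  apply: A_ker; have := horner_mx_main_poly A_sym.
  by rewrite ME rmorphM /= horner_mx_X -mulmxA.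
have [z cE] : exists z, c = z%:~R.
  exists ((horner_mx B p *m (const_mx 1 : 'cV_n.+1)) i0 0).
  transitivity ((c *: sigma) i0 0); first by rewrite mxE sigma_i0 mulr1.
  have oneE : ones R n.+1 = map_mx intr (const_mx 1 : 'cV[int]_n.+1).
    by rewrite map_const_mx.
  by rewrite -pA oneE -map_horner_mx -map_mxM mxE.
(* Pair [p(A) 1 = c sigma] with [sigma], a left eigenvector for 0. *)
have sign_gt0 : 0 < (-1) ^+ l.-1 * c.
  have sigmaA : sigma^T *m A = 0 *: sigma^T.
    by rewrite -{1}A_sym -trmx_mul A_sigma trmx0 scale0r.
  have sigma_norm : 0 < (sigma^T *m sigma) 0 0.
    rewrite lt_neqAle trmx_mulmx_ge0 andbT eq_sym; apply/eqP=> sigma0.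
    have sigma_eq0 : sigma = 0.
      by apply: trmx_mulmx_eq0; apply/matrixP=> i k; rewrite !ord1 sigma0 mxE.
    by move/eqP: sigma_i0; rewrite sigma_eq0 mxE eq_sym oner_eq0.
  have : c * (sigma^T *m sigma) 0 0 = pR.[0] * (sigma^T *m ones R n.+1) 0 0.
    have := congr1 (fun M => (sigma^T *m M) 0 0) pA.
    by rewrite mulmxA (row_eigen_horner _ sigmaA) -scalemxAl -scalemxAr !mxE.
  rewrite pR_prod horner_coef0 coef0_prod_XsubC s_size => cN.
  rewrite -(pmulr_lgt0 _ sigma_norm) -mulrA cN !mulrA -expr2 sqrr_sign mul1r.
  by rewrite pmulr_lgt0// big_seq prodr_gt0// => a /(allP s_pos).
have c0 : c != 0 by apply: contraTneq sign_gt0 => ->; rewrite mulr0 ltxx.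
exists `|z|%N, p; split=> //.
- by rewrite absz_gt0 -(intr_eq0 R) -cE.
- by exists s; split=> //; apply/rem_uniq/uniq_main_eigenvalues.
split.
  have pR_monic : pR \is monic by apply: monic_map.
  have pR_size : size pR = l.-1.+1.
    by rewrite size_map_inj_poly ?prednK//; apply: intr_inj.
  apply/(free_krylov_rcons pR_monic pR_size c0 pA) => q q_le qA.
  apply/eqP; apply: contraTT q_le => q0; rewrite -ltnNge prednK// -l_size.
  by rewrite -size_main_poly dvdp_leq// dvdp_main_poly// qA.
rewrite poly_mxE pA; congr (_ *: _).
have -> : `|z|%N%:R = (-1) ^+ l.-1 * c.
  by rewrite natr_absz intr_norm -cE -[RHS]gtr0_norm// normrM normr_sign mul1r.
by rewrite mulrA -expr2 sqrr_sign mul1r.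
Qed.

(** Since [i0 : 'I_n], the size [n] is positive, and the polynomial calculus on
    matrices of size [n'.+1] applies. *)
Lemma main_relation_equiv (R : rcfType) n (B : 'M[int]_n) (sigma : 'cV[R]_n)
    i0 l (A := map_mx intr B : 'M[R]_n) :
    A^T = A -> (forall x : 'cV[R]_n, 0 <= (x^T *m A *m x) 0 0) ->
    A *m sigma = 0 ->
    (forall x : 'cV[R]_n, A *m x = 0 -> exists c, x = c *: sigma) ->
    sigma i0 0 = 1 -> 0 < (sigma^T *m ones R n) 0 0 ->
  ((size (main_eigenvalues A) = l /\ 0 \in main_eigenvalues A)
   <-> (exists (t : nat) (p : {poly int}), main_relation A sigma l t p))
  /\ (forall (t : nat) (p : {poly int}), main_relation A sigma l t p ->
        main_poly A = 'X * map_poly intr p).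
Proof.
case: n B sigma i0 @A => [|n] B sigma i0 A; first by case: i0.
move=> A_sym A_psd A_sigma A_ker sigma_i0 sigma_one; split; last first.
  by move=> t p; apply: main_relation_main_poly.
split=> [[l_size main0]|[t [p p_rel]]].
  exact: (main_relation_exists A_sym A_psd A_sigma A_ker sigma_i0).
have ME := main_relation_main_poly A_sym A_sigma p_rel.
case: p_rel => _ p_monic p_size _ _; split; last first.
  by rewrite -root_prod_XsubC -/(main_poly A) ME rootM rootX eqxx.
apply: succn_inj; rewrite -size_main_poly ME.
have pR_monic : map_poly intr p \is @monic R by apply: monic_map.
rewrite size_monicM ?monicX ?monic_neq0// size_polyX size_map_inj_poly//.
  by rewrite p_size.
exact: intr_inj.
Qed.

(** * The signless Laplacian of a bipartite graph *)

Section SignlessLaplacian.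

Variables (R : rcfType) (T : finType) (e : rel T).
Local Notation Q := (signless_laplacian R e).

(** Every edge is counted in both directions, hence the factor 2 in
    [signless_laplacian_quad]. *)
Definition edge_sum (x : 'cV[R]_#|T|) :=
  \sum_i \sum_(j | e (enum_val i) (enum_val j)) (x i 0 + x j 0) ^+ 2.

Lemma degreeE (i : 'I_#|T|) :
  (degree e (enum_val i))%:R =
  \sum_(j : 'I_#|T| | e (enum_val i) (enum_val j)) 1 :> R.
Proof.
rewrite sumr_const /degree; congr _%:R.
rewrite -(card_imset _ (@enum_val_inj T T)); apply: eq_card => y.
rewrite inE; apply/idP/imsetP => [ey|[j ej ->] //].
by exists (enum_rank y); rewrite ?enum_rankK // unfold_in enum_rankK.
Qed.

Lemma signless_laplacian_mulE (x : 'cV[R]_#|T|) i :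
  (Q *m x) i 0 = \sum_(j | e (enum_val i) (enum_val j)) (x i 0 + x j 0).
Proof.
rewrite mulmxDl mul_diag_mx !mxE degreeE mulr_suml big_split /= addrC.
congr (_ + _); first by apply: eq_bigr => j _; rewrite mul1r.
rewrite [RHS]big_mkcond; apply: eq_bigr => j _; rewrite mxE.
by case: (e _ _); rewrite ?mul1r ?mul0r.
Qed.

Hypothesis e_sym : symmetric e.

Lemma tr_signless_laplacian : Q^T = Q.
Proof.
rewrite linearD /= tr_diag_mx; congr (_ + _).
by apply/matrixP=> i j; rewrite !mxE e_sym.
Qed.

(** By symmetry of [e], the double sum of [x_i (x_i + x_j)] over adjacent pairs
    equals that of [x_j (x_i + x_j)]; adding the two gives squares. *)
Lemma signless_laplacian_quad (x : 'cV[R]_#|T|) :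
  (x^T *m Q *m x) 0 0 *+ 2 = edge_sum x.
Proof.
have quadE : (x^T *m Q *m x) 0 0 =
    \sum_i \sum_(j | e (enum_val i) (enum_val j)) x i 0 * (x i 0 + x j 0).
  rewrite -mulmxA mxE; apply: eq_bigr => i _.
  by rewrite signless_laplacian_mulE mxE mulr_sumr.
rewrite mulr2n {2}quadE.
rewrite (exchange_big_dep predT) //= quadE -big_split /=.
apply: eq_bigr => i _.
rewrite [X in _ + X](eq_bigl (fun j => e (enum_val i) (enum_val j))).
  rewrite -big_split; apply: eq_bigr => j _ /=.
  by rewrite (addrC (x j 0)) -mulrDl.
by move=> j; rewrite e_sym.
Qed.

Lemma edge_sum_ge0 x : 0 <= edge_sum x.
Proof. by apply: sumr_ge0 => i _; apply: sumr_ge0 => j _; rewrite sqr_ge0. Qed.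

Lemma signless_laplacian_psd (x : 'cV[R]_#|T|) : 0 <= (x^T *m Q *m x) 0 0.
Proof.
by rewrite -(pmulrn_lge0 _ (ltn0Sn 1)) signless_laplacian_quad edge_sum_ge0.
Qed.

(** A kernel vector makes the sum of the squares [(x_i + x_j)^2] vanish, hence
    each of them. *)
Lemma signless_laplacian_ker_edge (x : 'cV[R]_#|T|) i j :
  Q *m x = 0 -> e (enum_val i) (enum_val j) -> x i 0 = - x j 0.
Proof.
move=> Qx eij; have := signless_laplacian_quad x.
rewrite -mulmxA Qx mulmx0 mxE mul0rn => /esym/eqP.
rewrite psumr_eq0 => [/allP/(_ i (mem_index_enum i))|k _]; last first.
  by apply: sumr_ge0 => *; rewrite sqr_ge0.
rewrite /= psumr_eq0 => [/allP/(_ j (mem_index_enum j))|k _];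
  last exact: sqr_ge0.
by rewrite eij sqrf_eq0 addr_eq0 => /eqP.
Qed.

Variables (Vp Vm : {set T}).
Hypothesis bip : bipartition e Vp Vm.
Local Notation sigma := (sign_vector R Vp).

Lemma sign_vector_edge i j :
  e (enum_val i) (enum_val j) -> sigma i 0 = - sigma j 0.
Proof.
move=> eij; case: bip => cover _ indp indm; rewrite !mxE.
have inVm y : y \notin Vp -> y \in Vm.
  by have := in_setT y; rewrite -cover inE => /orP[->|].
case: ifPn => ip; case: ifPn => jp; rewrite ?opprK //.
  by have := indp _ _ ip jp; rewrite eij.
by have := indm _ _ (inVm _ ip) (inVm _ jp); rewrite eij.
Qed.

Lemma signless_laplacian_sign_vector : Q *m sigma = 0.
Proof.
apply/colP=> i; rewrite signless_laplacian_mulE [RHS]mxE big1 // => j eij.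
by rewrite (sign_vector_edge eij) addNr.
Qed.

(** Both [x] and [sigma] change sign along each edge, so their entrywise product
    [g] is constant on the connected graph. *)
Lemma signless_laplacian_ker (x : 'cV[R]_#|T|) : connected_graph e ->
  Q *m x = 0 -> exists c, x = c *: sigma.
Proof.
move=> e_conn Qx.
have sigma2 i : sigma i 0 * sigma i 0 = 1.
  by rewrite mxE; case: ifP; rewrite ?mulr1 ?mulrNN ?mulr1.
pose g (y : T) := x (enum_rank y) 0 * sigma (enum_rank y) 0.
have g_edge y z : e y z -> g y = g z.
  move=> eyz; rewrite /g.
  have eyz' : e (enum_val (enum_rank y)) (enum_val (enum_rank z)).
    by rewrite !enum_rankK.
  rewrite (signless_laplacian_ker_edge Qx eyz') (sign_vector_edge eyz').
  by rewrite mulrNN.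
have g_const y z : g y = g z.
  have /connectP[p] := e_conn y z.
  elim: p y => [y _ -> //|w p IHp y /= /andP[eyw ewp] zE].
  by rewrite (g_edge _ _ eyw); apply: IHp.
have [i _|T0] := pickP 'I_#|T|; last first.
  by exists 0; apply/colP=> i; have := T0 i.
exists (g (enum_val i)); apply/colP=> j; rewrite [RHS]mxE.
by rewrite (g_const _ (enum_val j)) /g enum_valK -mulrA sigma2 mulr1.
Qed.

Lemma sign_vector_sum :
  (sigma^T *m ones R #|T|) 0 0 = #|Vp|%:R - #|Vm|%:R.
Proof.
case: bip => cover dis _ _; rewrite mxE.
transitivity (\sum_(y : T) if y \in Vp then 1 else -1 : R).
  rewrite [RHS](reindex (@enum_val T T)) /=; last exact/onW_bij/enum_val_bij.
  by apply: eq_bigr => i _; rewrite !mxE mulr1.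
rewrite (bigID (mem Vp)) /=; congr (_ + _).
  by rewrite (eq_bigr (fun=> 1)) ?sumr_const // => y ->.
rewrite (eq_bigr (fun=> -1)) => [|y /negPf -> //]; rewrite sumr_const mulNrn.
congr (- _%:R); apply: eq_card => y; rewrite -[LHS]/(y \notin Vp).
have := in_setT y; rewrite -cover inE.
have [yp _|_ /= -> //] := boolP (y \in Vp).
by rewrite (disjointFr dis yp).
Qed.

End SignlessLaplacian.

Theorem theorem3p1 (R : rcfType) (T : finType) (e : rel T) (Vp Vm : {set T})
    (l : nat)
    (e_sym : symmetric e) (e_irr : irreflexive e) (e_conn : connected_graph e)
    (e_edge : exists x y : T, e x y)
    (l_ge3 : (3 <= l)%N)
    (bip : bipartition e Vp Vm) (Vp_gt : (#|Vm| < #|Vp|)%N) :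
  let Q : 'M[R]_#|T| := signless_laplacian R e in
  let sigma : 'cV[R]_#|T| := sign_vector R Vp in
  ((size (main_eigenvalues Q) = l /\ 0 \in main_eigenvalues Q)
   <-> (exists (t : nat) (p : {poly int}), main_relation Q sigma l t p))
  /\ (forall (t : nat) (p : {poly int}), main_relation Q sigma l t p ->
        main_poly Q = 'X * map_poly intr p).
Proof.
move=> Q sigma.
pose B : 'M[int]_#|T| :=
  \matrix_(i, j) (e (enum_val i) (enum_val j))%:R
  + diag_mx (\row_i (degree e (enum_val i))%:R).
have QE : Q = map_mx intr B.
  rewrite map_mxD map_diag_mx; congr (_ + diag_mx _).
    by apply/matrixP=> i j; rewrite !mxE [RHS](rmorph_nat intr).
  by apply/rowP=> i; rewrite !mxE [RHS](rmorph_nat intr).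
have /card_gt0P[y0 y0_Vp] : (0 < #|Vp|)%N by apply: leq_ltn_trans Vp_gt.
rewrite QE; apply: (main_relation_equiv (i0 := enum_rank y0)); rewrite -?QE.
- exact: tr_signless_laplacian.
- exact: signless_laplacian_psd.
- exact: signless_laplacian_sign_vector bip.
- by move=> x; exact: (signless_laplacian_ker e_sym bip e_conn).
- by rewrite mxE enum_rankK y0_Vp.
by rewrite (sign_vector_sum _ bip) subr_gt0 ltr_nat.
Qed.
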